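(* Let $\mathscr{G}$ be a topological groupoid, let $K$ be a locally compact Hausdorff topological group and let $\rho\in\hom(K,\mathscr{G})$. (i) For any $\varphi\in\hom(K,\mathscr{G};\rho)$ we have $\mathrm{Mon}(\mathscr{G};\varphi)=\mathrm{Mon}(\mathscr{G};\rho)$. (ii) For any arrow $g\in\mathscr{G}$ with source $\omega(\rho)$ we have $\mathrm{Mon}(\mathscr{G};\mathrm{c}_g\circ\rho)=\mathrm{Mon}(\mathscr{G};\rho)$. (iii) For any continuous isomorphism $\alpha:L\to K$ between topological groups, where $L$ is locally compact Hausdorff, we have $\mathrm{Mon}(\mathscr{G};\rho\circ\alpha)=\alpha^{-1}\circ\mathrm{Mon}(\mathscr{G};\rho)\circ\alpha$. (iv) If $\rho$ is a monomorphism, then $\rho\circ\mathrm{Mon}(\mathscr{G};\rho)=\mathrm{Mon}(\mathscr{G};\mathrm{id}_{\rho(K)})\circ\rho$. (v) The group $\mathrm{Inn}(K)$ of inner automorphisms of $K$ is a normal subgroup of the monodromy group $\mathrm{Mon}(\mathscr{G};\rho)$.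
   Context: A topological groupoid $\mathscr{G}$ is a groupoid with topologies on its set of arrows $\mathscr{G}_1$ (also written $\mathscr{G}$) and its set of objects $\mathscr{G}_0$ such that all structure maps are continuous; $\mathrm{s},\mathrm{t}$ are source and target, and $\mathrm{I}_x(\mathscr{G})$ is the isotropy group at $x$ (arrows from $x$ to $x$), a topological group. For an arrow $g$, $\mathrm{c}_g:\mathrm{I}_{\mathrm{s}(g)}(\mathscr{G})\to\mathrm{I}_{\mathrm{t}(g)}(\mathscr{G})$ is $\mathrm{c}_g(h)=ghg^{-1}$. $\hom(K,\mathscr{G})$ is the set of all homomorphisms of topological groupoids from $K$ to $\mathscr{G}$; such a homomorphism $\varphi$ is given by a point $\omega(\varphi)\in\mathscr{G}_0$ and a continuous group homomorphism $\varphi:K\to\mathrm{I}_{\omega(\varphi)}(\mathscr{G})$. It is topologized as a subspace of the space $C(K,\mathscr{G})$ of continuous maps from $K$ to $\mathscr{G}$ with the compact-open topology. $\mathscr{G}$ acts on it from the left along $\omega$ by $g\varphi=\mathrm{c}_g\circ\varphi$, for $\mathrm{s}(g)=\omega(\varphi)$. $\hom(K,\mathscr{G};\rho)$ is the smallest subset of $\hom(K,\mathscr{G})$ which contains $\rho$, is a union of path-components of $\hom(K,\mathscr{G})$ and is invariant under the $\mathscr{G}$-action. With $\mathrm{Aut}(K)$ the group of automorphisms of the topological group $K$, the monodromy group of $\mathscr{G}$ at $\rho$ is $$\mathrm{Mon}(\mathscr{G};\rho)=\{\mu\in\mathrm{Aut}(K)\;|\;\hom(K,\mathscr{G};\rho)\circ\mu=\hom(K,\mathscr{G};\rho)\}.$$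 The same definitions are used with $L$ in (iii), and with $\rho(K)$ in (iv), in place of $K$. A monomorphism is an injective homomorphism. In (iv), $\rho(K)$ is the image of $\rho$, a subgroup of the topological group $\mathrm{I}_{\omega(\rho)}(\mathscr{G})$, and $\mathrm{id}_{\rho(K)}$ is the identity of $\rho(K)$ viewed as a homomorphism from $\rho(K)$ to $\mathscr{G}$, i.e. the inclusion $\rho(K)\to\mathrm{I}_{\omega(\rho)}(\mathscr{G})$. Compositions with sets of maps are taken elementwise.
   Formalization: In (iii) the isomorphism α is also required to have a continuous inverse; in (iv) the monomorphism ρ is required to be a topological embedding, or else ρ(K) carries the topology transported from K instead of the subspace topology. Without these changes (iii) and (iv) fail. *)

(* Defs.v *)
From HB Require Import structures.
From mathcomp Require Import all_boot all_order all_algebra monoid.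
From mathcomp Require Import boolp classical_sets functions set_interval reals.
From mathcomp Require Import topology normedtype.

Set Implicit Arguments.
Unset Strict Implicit.
Unset Printing Implicit Defensive.

Import Order.TTheory GRing.Theory Num.Theory numFieldNormedType.Exports.

Local Open Scope classical_set_scope.

Lemma continuous_to_initial (X T : topologicalType) (S : choiceType)
    (g : S -> T) (f : X -> S) :
  continuous (g \o f) -> continuous (f : X -> initial_topology g).
Proof.
move=> /continuousP gf; apply/continuousP => _ [B oB <-].
exact: (gf B oB).
Qed.

Lemma continuous_pair (X S T : topologicalType) (f : X -> S) (g : X -> T) :
  continuous f -> continuous g -> continuous (fun x => (f x, g x)).
Proof. by move=> cf cg x; apply: cvg_pair; [exact: cf | exact: cg]. Qed.

HB.mixin Record isTopologicalGroup G & Topological G & Group G := {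
  mulg_continuous : continuous (fun p : G * G => (p.1 * p.2)%g);
  invg_continuous : continuous (fun x : G => (x^-1)%g)
}.

#[short(type="topGroupType")]
HB.structure Definition TopologicalGroup :=
  {G of Topological G & Group G & isTopologicalGroup G}.

(* [tg_inv f] is a field, so a [topGroupIso] is a homomorphism that is also a
   homeomorphism. *)
Record topGroupIso (L K : topGroupType) := TopGroupIso {
  tg_fun :> L -> K;
  tg_inv : K -> L;
  tg_funK : cancel tg_fun tg_inv;
  tg_invK : cancel tg_inv tg_fun;
  tg_funM : {morph tg_fun : x y / (x * y)%g >-> (x * y)%g};
  tg_fun_continuous : continuous tg_fun;
  tg_inv_continuous : continuous tg_inv
}.

Lemma topGroupIso_eq (L K : topGroupType) (f g : topGroupIso L K) :
  f =1 g -> f = g.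
Proof.
case: f g => [f fi fK fiK fM fc fic] [g gi gK giK gM gc gic] /= /funext fg.
subst g.
have e : fi = gi by apply/funext => y; rewrite -{1}(giK y) fK.
subst gi; congr TopGroupIso; exact: Prop_irrelevance.
Qed.

Section Isomorphisms.
Variables M L K : topGroupType.

Lemma tg_invM (f : topGroupIso L K) :
  {morph tg_inv f : x y / (x * y)%g >-> (x * y)%g}.
Proof.
by move=> x y; apply: (can_inj (tg_funK f)); rewrite tg_funM !tg_invK.
Qed.

Definition iso_inv (f : topGroupIso L K) : topGroupIso K L :=
  TopGroupIso (tg_invK f) (tg_funK f) (tg_invM f)
    (@tg_inv_continuous _ _ f) (@tg_fun_continuous _ _ f).

Definition iso_id : topGroupIso K K :=
  TopGroupIso (fun _ => erefl) (fun _ => erefl) (fun _ _ => erefl)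
    (fun _ => cvg_id) (fun _ => cvg_id).

Variables (f : topGroupIso L K) (g : topGroupIso M L).

Let compM : {morph f \o g : x y / (x * y)%g >-> (x * y)%g}.
Proof. by move=> x y; rewrite /= !tg_funM. Qed.

Let comp_cont : continuous (f \o g).
Proof.
by move=> x; apply: continuous_comp; apply: tg_fun_continuous.
Qed.

Let comp_inv_cont : continuous (tg_inv g \o tg_inv f).
Proof.
by move=> x; apply: continuous_comp; apply: tg_inv_continuous.
Qed.

Definition iso_comp : topGroupIso M K :=
  TopGroupIso (can_comp (tg_funK f) (tg_funK g))
    (can_comp (tg_invK g) (tg_invK f)) compM comp_cont comp_inv_cont.

End Isomorphisms.

Definition tgAut (K : topGroupType) : Type := topGroupIso K K.

HB.instance Definition _ (K : topGroupType) := gen_eqMixin (tgAut K).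
HB.instance Definition _ (K : topGroupType) := gen_choiceMixin (tgAut K).

Section AutGroup.
Variable K : topGroupType.
Implicit Types mu nu : tgAut K.

Let autA : associative (fun mu nu : tgAut K => iso_comp mu nu : tgAut K).
Proof. by move=> a b c; apply: topGroupIso_eq. Qed.
Let aut1g : left_id (@iso_id K : tgAut K) (fun mu nu => iso_comp mu nu).
Proof. by move=> a; apply: topGroupIso_eq. Qed.
Let autg1 : right_id (@iso_id K : tgAut K) (fun mu nu => iso_comp mu nu).
Proof. by move=> a; apply: topGroupIso_eq. Qed.
Let autVg : left_inverse (@iso_id K : tgAut K) (@iso_inv K K)
  (fun mu nu => iso_comp mu nu).
Proof. by move=> a; apply: topGroupIso_eq => x /=; rewrite tg_funK. Qed.
Let autgV : right_inverse (@iso_id K : tgAut K) (@iso_inv K K)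
  (fun mu nu => iso_comp mu nu).
Proof. by move=> a; apply: topGroupIso_eq => x /=; rewrite tg_invK. Qed.

(* The product of [tgAut K] is composition: [(mu * nu) x = mu (nu x)]. *)
HB.instance Definition _ :=
  isGroup.Build (tgAut K) autA aut1g autg1 autVg autgV.

Definition inner_fun (k x : K) : K := (k * x * k^-1)%g.

Let innerK k : cancel (inner_fun k) (inner_fun k^-1%g).
Proof. by move=> x; rewrite /inner_fun invgK !mulgA mulVg mul1g mulgVK. Qed.

Let innerVK k : cancel (inner_fun k^-1%g) (inner_fun k).
Proof. by move=> x; rewrite /inner_fun invgK !mulgA mulgV mul1g mulgK. Qed.

Let innerM k : {morph inner_fun k : x y / (x * y)%g >-> (x * y)%g}.
Proof. by move=> x y; rewrite /inner_fun !mulgA mulgVK. Qed.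

Let inner_cont k : continuous (inner_fun k).
Proof.
have cst_cont (a : K) : continuous (fun _ : K => a) by move=> ?; exact: cvg_cst.
have mul_cont (f g : K -> K) : continuous f -> continuous g ->
    continuous (fun x => f x * g x)%g.
  move=> cf cg x; apply: (@continuous_comp _ _ _ (fun x => (f x, g x))
    (fun p => p.1 * p.2)%g); first exact: continuous_pair.
  exact: mulg_continuous.
by apply: (mul_cont _ _ _ (cst_cont _)); apply: mul_cont => // x; exact: cvg_id.
Qed.

Definition inner_aut (k : K) : tgAut K :=
  TopGroupIso (innerK k) (innerVK k) (@innerM k) (@inner_cont k)
    (@inner_cont k^-1%g).

Definition Inn : set (tgAut K) := range inner_aut.

End AutGroup.

Definition normal_subgroup (gT : groupType) (N H : set gT) : Prop :=
  [/\ group_closed [in N], group_closed [in H], N `<=` H &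
      forall n h : gT, N n -> H h -> N (h * n * h^-1)%g].

(* Arrows compose as maps do: [gmul g h] is the composite [gh], for
   [src g = tgt h]. It is a total function, but the axioms constrain it on
   composable pairs only; its other values are irrelevant. *)
Record topGroupoid := TopGroupoid {
  obj : topologicalType;
  arr :> topologicalType;
  src : arr -> obj;
  tgt : arr -> obj;
  gone : obj -> arr;
  ginv : arr -> arr;
  gmul : arr -> arr -> arr;
  src_gone : forall x, src (gone x) = x;
  tgt_gone : forall x, tgt (gone x) = x;
  src_ginv : forall g, src (ginv g) = tgt g;
  tgt_ginv : forall g, tgt (ginv g) = src g;
  src_gmul : forall g h, src g = tgt h -> src (gmul g h) = src h;
  tgt_gmul : forall g h, src g = tgt h -> tgt (gmul g h) = tgt g;
  gmulA : forall g h k, src g = tgt h -> src h = tgt k ->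
    gmul g (gmul h k) = gmul (gmul g h) k;
  gmul1l : forall g, gmul (gone (tgt g)) g = g;
  gmul1r : forall g, gmul g (gone (src g)) = g;
  gmulVl : forall g, gmul (ginv g) g = gone (src g);
  gmulVr : forall g, gmul g (ginv g) = gone (tgt g);
  src_continuous : continuous src;
  tgt_continuous : continuous tgt;
  gone_continuous : continuous gone;
  ginv_continuous : continuous ginv;
  gmul_continuous : {within [set p : arr * arr | src p.1 = tgt p.2],
                      continuous (fun p => gmul p.1 p.2)}
}.

Section Homomorphisms.
Variables (K : topGroupType) (G : topGroupoid).
Implicit Types phi psi : K -> G.

Definition tg_hom : set (K -> G) :=
  [set phi | [/\ exists x, forall k, src (phi k) = x /\ tgt (phi k) = x,
                 {morph phi : k l / (k * l)%g >-> gmul k l} &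
                 continuous phi]].

Definition omega phi : obj G := src (phi 1%g).

Definition conj_hom (g : G) phi : K -> G :=
  fun k => gmul (gmul g (phi k)) (ginv g).

Variable R : realType.

(* A continuous path in the subspace [tg_hom] of the compact-open function space
   is a path in that function space all of whose values lie in [tg_hom]. *)
Definition hom_path_component phi : set (K -> G) :=
  [set psi | exists gamma : R -> {compact-open, K -> G},
    [/\ {within `[0%R, 1%R], continuous gamma},
        forall t, `[0%R, 1%R] t -> tg_hom (gamma t),
        gamma 0%R = phi & gamma 1%R = psi]].

Definition hom_saturated (A : set (K -> G)) : Prop :=
  [/\ A `<=` tg_hom,
      exists2 B : set (K -> G), B `<=` tg_hom &
        A = \bigcup_(phi in B) hom_path_component phi &
      forall (g : G) phi, A phi -> src g = omega phi -> A (conj_hom g phi)].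

Definition hom_at (rho : K -> G) : set (K -> G) :=
  smallest hom_saturated [set rho].

Definition Mon (rho : K -> G) : set (tgAut K) :=
  [set mu : tgAut K | [set phi \o mu | phi in hom_at rho] = hom_at rho].

End Homomorphisms.

Section ImageGroup.
Variables (K : topGroupType) (G : topGroupoid) (rho : K -> G).
Hypothesis hrho : tg_hom rho.

(* The set underlying [rho(K)]. Its group structure needs the proof [hrho] that
   [rho] is a homomorphism, hence the otherwise unused argument. *)
Definition hom_image_set : Type := let _ := hrho in range rho.
Local Notation I := hom_image_set.

HB.instance Definition _ := Choice.on I.

Definition image_incl : I -> G := @set_val _ (range rho).

Definition corestr (k : K) : I :=
  exist _ (rho k) (mem_set (imageT rho k)).

Lemma image_incl_inj : injective image_incl. Proof. exact: val_inj. Qed.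

Lemma corestr_surj (y : I) : exists k, corestr k = y.
Proof.
by have [k _ e] := set_mem (valP y); exists k; apply: val_inj.
Qed.

Lemma hom_src_tgt k l : src (rho k) = tgt (rho l).
Proof. by case: hrho => [[x hx] _ _]; rewrite (hx k).1 (hx l).2. Qed.

Lemma image_incl_src_tgt (y z : I) : src (image_incl y) = tgt (image_incl z).
Proof.
have [k <-] := corestr_surj y; have [l <-] := corestr_surj z.
exact: hom_src_tgt.
Qed.

Lemma homM k l : rho (k * l)%g = gmul (rho k) (rho l).
Proof. by case: hrho. Qed.

Lemma hom1 : rho 1%g = gone (src (rho 1%g)).
Proof.
have e := hom_src_tgt.
rewrite -[LHS]gmul1l -(e 1%g 1%g) -[in LHS](gmulVl (rho 1%g)).
by rewrite -(gmulA (src_ginv _) (e _ _)) -homM mulg1 gmulVl.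
Qed.

Lemma homV k : rho k^-1%g = ginv (rho k).
Proof.
have e := hom_src_tgt.
rewrite -[LHS]gmul1l -(e k) -(gmulVl (rho k)) -(gmulA (src_ginv _) (e _ _)).
by rewrite -homM mulgV hom1 (e 1%g k) -src_ginv gmul1r.
Qed.

Let mul_subproof (y z : I) : gmul (image_incl y) (image_incl z) \in range rho.
Proof.
have [k <-] := corestr_surj y; have [l <-] := corestr_surj z.
by apply: mem_set; exists (k * l)%g => //; exact: homM.
Qed.

Let inv_subproof (y : I) : ginv (image_incl y) \in range rho.
Proof.
have [k <-] := corestr_surj y.
by apply: mem_set; exists (k^-1)%g => //; exact: homV.
Qed.

Let mul (y z : I) : I :=
  exist _ (gmul (image_incl y) (image_incl z)) (mul_subproof y z).
Let one : I := corestr 1%g.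
Let inv (y : I) : I := exist _ (ginv (image_incl y)) (inv_subproof y).

Let inclM y z : image_incl (mul y z) = gmul (image_incl y) (image_incl z).
Proof. by []. Qed.
Let inclV y : image_incl (inv y) = ginv (image_incl y). Proof. by []. Qed.
Let incl1 : image_incl one = gone (src (image_incl one)).
Proof. exact: hom1. Qed.

Let mulA : associative mul.
Proof.
move=> a b c; apply: image_incl_inj; rewrite !inclM gmulA //.
  exact: image_incl_src_tgt.
exact: image_incl_src_tgt.
Qed.

Let mul1 : left_id one mul.
Proof.
move=> a; apply: image_incl_inj; rewrite inclM incl1.
by rewrite (image_incl_src_tgt one a) gmul1l.
Qed.

Let mulr1 : right_id one mul.
Proof.
move=> a; apply: image_incl_inj; rewrite inclM incl1.
by rewrite (image_incl_src_tgt one a) -(image_incl_src_tgt a a) gmul1r.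
Qed.

Let mulV : left_inverse one inv mul.
Proof.
move=> a; apply: image_incl_inj; rewrite inclM inclV incl1 gmulVl.
by rewrite (image_incl_src_tgt one a) -(image_incl_src_tgt a a).
Qed.

Let mulVr : right_inverse one inv mul.
Proof.
move=> a; apply: image_incl_inj; rewrite inclM inclV incl1 gmulVr.
by rewrite (image_incl_src_tgt one a).
Qed.

HB.instance Definition _ := isGroup.Build I mulA mul1 mulr1 mulV mulVr.

Lemma corestrM : {morph corestr : k l / (k * l)%g >-> (k * l)%g}.
Proof. by move=> k l; apply: image_incl_inj; exact: homM. Qed.

Lemma corestrV k : corestr k^-1%g = (corestr k)^-1%g.
Proof. by apply: image_incl_inj; exact: homV. Qed.

(* [rho(K)] as a topological subgroup of the isotropy group at [omega rho]: it
   carries the subspace topology. *)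
Definition hom_image : Type := I.

HB.instance Definition _ := Group.on hom_image.
HB.instance Definition _ :=
  Topological.copy hom_image (initial_topology image_incl).

Let image_incl_cont : continuous (image_incl : hom_image -> G).
Proof. exact: initial_continuous. Qed.

Let image_mul_cont :
  continuous (fun p : hom_image * hom_image => (p.1 * p.2)%g).
Proof.
pose D := [set p : G * G | src p.1 = tgt p.2].
pose f (p : hom_image * hom_image) : G * G := (image_incl p.1, image_incl p.2).
have fD p : D (f p) by exact: image_incl_src_tgt.
have cf : continuous f.
  apply: continuous_pair => p.
    apply: (@continuous_comp _ _ _ fst image_incl); first exact: cvg_fst.
    exact: image_incl_cont.
  apply: (@continuous_comp _ _ _ snd image_incl); first exact: cvg_snd.
  exact: image_incl_cont.
apply: continuous_to_initial => p.
suff fcvg : f @ p --> (f p : subspace D).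
  apply: (@continuous_comp _ (subspace D) _ f (fun q => gmul q.1 q.2)) => //.
  exact: (@gmul_continuous G).
apply/(@subspace_cvgP _ D (f @ p) (f p)); first exact: fD.
move=> W /cf; rewrite /= !nbhs_simpl /=.
by apply: filterS => q; apply; exact: fD.
Qed.

Let image_inv_cont : continuous (fun y : hom_image => (y^-1)%g).
Proof.
apply: continuous_to_initial => y.
apply: (@continuous_comp _ _ _ image_incl (@ginv G)).
  exact: image_incl_cont.
exact: ginv_continuous.
Qed.

HB.instance Definition _ :=
  isTopologicalGroup.Build hom_image image_mul_cont image_inv_cont.

Hypothesis rho_inj : injective rho.

Definition corestr_inv (y : I) : K := sval (cid2 (set_mem (valP y))).

Lemma corestr_invK : cancel corestr_inv corestr.
Proof. by move=> y; apply: val_inj; rewrite /corestr_inv; case: cid2. Qed.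

Lemma corestrK : cancel corestr corestr_inv.
Proof.
move=> k; apply: rho_inj.
exact: (congr1 image_incl (corestr_invK (corestr k))).
Qed.

Lemma corestr_invM : {morph corestr_inv : y z / (y * z)%g >-> (y * z)%g}.
Proof.
move=> y z; rewrite -{1}(corestr_invK y) -{1}(corestr_invK z).
by rewrite -corestrM corestrK.
Qed.

Lemma corestr_invV y : corestr_inv y^-1%g = (corestr_inv y)^-1%g.
Proof. by rewrite -{1}(corestr_invK y) -corestrV corestrK. Qed.

(* [rho(K)] for an injective [rho], with the topology carried over from [K]
   along the bijection [corestr]. It refines the subspace topology, and equals
   it exactly when [rho] is a topological embedding. For an arbitrary injective
   [rho] the subspace topology may have fewer continuous automorphisms: with
   [K] the discrete group Z^2 and [rho (a, b) = a + b * sqrt 2] in the reals,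
   swapping [a] and [b] is not continuous on [rho(K)]. *)
Definition hom_copy : Type := let _ := rho_inj in I.

HB.instance Definition _ := Group.on hom_copy.
HB.instance Definition _ :=
  Topological.copy hom_copy (initial_topology corestr_inv).

Let corestr_inv_cont : continuous (corestr_inv : hom_copy -> K).
Proof. exact: initial_continuous. Qed.

Let copy_mul_cont :
  continuous (fun p : hom_copy * hom_copy => (p.1 * p.2)%g).
Proof.
apply: continuous_to_initial => p.
pose f (q : hom_copy * hom_copy) : K * K := (corestr_inv q.1, corestr_inv q.2).
have -> : corestr_inv \o (fun p : hom_copy * hom_copy => (p.1 * p.2)%g) =
    (fun q : K * K => (q.1 * q.2)%g) \o f.
  by apply/funext => q; exact: corestr_invM.
apply: continuous_comp; last exact: mulg_continuous.
apply: continuous_pair => q.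
  apply: (@continuous_comp _ hom_copy _ fst corestr_inv); first exact: cvg_fst.
    exact: corestr_inv_cont.
apply: (@continuous_comp _ hom_copy _ snd corestr_inv); first exact: cvg_snd.
  exact: corestr_inv_cont.
Qed.

Let copy_inv_cont : continuous (fun y : hom_copy => (y^-1)%g).
Proof.
apply: continuous_to_initial => y.
have -> : corestr_inv \o (fun y : hom_copy => (y^-1)%g) =
    (fun k : K => (k^-1)%g) \o corestr_inv.
  by apply/funext => z; exact: corestr_invV.
apply: (@continuous_comp _ _ _ (corestr_inv : hom_copy -> K)).
  exact: corestr_inv_cont.
exact: invg_continuous.
Qed.

HB.instance Definition _ :=
  isTopologicalGroup.Build hom_copy copy_mul_cont copy_inv_cont.

End ImageGroup.

Definition topological_embedding (X Y : topologicalType) (f : X -> Y) : Prop :=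
  [/\ injective f, continuous f &
      forall U : set X, open U -> exists2 V : set Y, open V & f @^-1` V = U].

Arguments image_incl {K G rho} hrho y.

(* Main.v *)
Require Import Defs.
From HB Require Import structures.
From mathcomp Require Import all_boot all_order all_algebra monoid.
From mathcomp Require Import boolp classical_sets functions set_interval reals.
From mathcomp Require Import topology normedtype.
From mathcomp Require Import lra.

Set Implicit Arguments.
Unset Strict Implicit.
Unset Printing Implicit Defensive.

Local Open Scope classical_set_scope.

(** The set hom(K, G; rho) is the class of rho for the equivalence relation
    generated by paths of homomorphisms and by the action of G. Precomposition
    with an isomorphism is compatible with both generators, hence
    hom(K, G; rho) o alpha = hom(L, G; rho o alpha). In particular mu lies in
    Mon(G; rho) if and only if rho o mu lies in hom(K, G; rho). Then (iv) is
    (iii) for the corestriction K -> rho(K), and Inn(K) lies in Mon(G; rho) because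
    rho o inn_k = c_(rho k) o rho. *)

(** Serves to reparametrize paths, whose continuity is given on [0, 1] only, and to multiply
    arrow-valued maps, as [gmul] is given continuous on composable pairs only. *)
Lemma within_continuous_comp (X Y Z : topologicalType) (A : set X) (B : set Y)
    (g : Y -> Z) (h : X -> Y) :
  {within A, continuous h} -> (forall x, A x -> B (h x)) ->
  {within B, continuous g} -> {within A, continuous (g \o h)}.
Proof.
move=> ch hAB cg; apply/subspace_continuousP => x Ax.
have gh := (@subspace_continuousP _ B _ g).1 cg (h x) (hAB x Ax).
apply: cvg_comp gh => W hW.
have := (@subspace_continuousP _ A _ h).1 ch x Ax _ hW.
rewrite /= !nbhs_simpl /= /within /=.
by apply: filterS => y; move=> /[swap] Ay /(_ Ay); apply; exact: hAB.
Qed.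

Arguments within_continuous_comp {X Y Z A} B g h.

(** * Being joined by a path is an equivalence relation on homomorphisms *)

Section PathComponents.
Local Open Scope ring_scope.
Import Order.TTheory GRing.Theory Num.Theory numFieldNormedType.Exports.
Variables (R : realType) (K : topGroupType) (G : topGroupoid).
Implicit Types phi psi chi : K -> G.
Local Notation pathc := (@hom_path_component K G R).

Lemma hom_path_component_hom phi psi :
  pathc phi psi -> tg_hom phi /\ tg_hom psi.
Proof.
by case=> p [_ hp <- <-]; split; apply: hp; rewrite /= in_itv /= lexx ler01.
Qed.

Lemma hom_path_component_refl phi : tg_hom phi -> pathc phi phi.
Proof.
move=> hphi; exists (fun=> phi); split => //.
by apply: continuous_subspaceT => x; exact: cvg_cst.
Qed.

Lemma hom_path_component_sym phi psi : pathc phi psi -> pathc psi phi.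
Proof.
case=> p [cp hp p0 p1]; exists (p \o (fun t => 1 - t)); split.
- apply: (@within_continuous_comp R R _ _ `[0, 1]%classic
    p (fun t => 1 - t)) => //.
    apply: continuous_subspaceT => t; apply: continuousB; first exact: cvg_cst.
    exact: cvg_id.
  by move=> t /=; rewrite !in_itv /= => ?; lra.
- by move=> t /=; rewrite in_itv /= => ?; apply: hp; rewrite /= in_itv /=; lra.
- by rewrite /= subr0.
- by rewrite /= subrr.
Qed.

Lemma hom_path_component_trans phi psi chi :
  pathc phi psi -> pathc psi chi -> pathc phi chi.
Proof.
case=> p [cp hp p0 p1] [q [cq hq q0 q1]].
pose r (t : R) : {compact-open, K -> G} :=
  if t <= 2^-1 then p (2 * t) else q (2 * t - 1).
have rp t : t <= 2^-1 -> r t = p (2 * t) by rewrite /r => ->.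
(* The endpoint t = 1/2 is included: there the two branches agree, since [p 1 = psi = q 0]. *)
have rq t : 2^-1 <= t -> r t = q (2 * t - 1).
  rewrite le_eqVlt => /predU1P[<-|]; last by rewrite /r ltNge => /negPf ->.
  rewrite /r lexx divff ?pnatr_eq0 // subrr.
  exact: etrans p1 (esym q0).
have double : continuous (fun t : R => 2 * t) by exact: mulrl_continuous.
exists r; split.
(* Continuity is glued over two closed halves, on each of which [r] is a single reparametrized
   path. *)
- have -> : [set` `[0, 1]] = `[0, 2^-1] `|` `[2^-1, 1] :> set R.
    apply/seteqP; split => t /=; rewrite !in_itv /=.
      by case: (leP t 2^-1) => ? ?; [left | right]; lra.
    by case=> ?; lra.
  apply: withinU_continuous; try exact: interval_closed.
    apply: (@subspace_eq_continuous _ _ _ (p \o (fun t => 2 * t))).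
      by move=> t; rewrite inE /= in_itv /= => ?; apply/esym/rp; lra.
    apply: (@within_continuous_comp R R _ _ `[0, 1]%classic
    p (fun t => 2 * t)) => //.
      exact: continuous_subspaceT.
    by move=> t /=; rewrite !in_itv /= => ?; lra.
  apply: (@subspace_eq_continuous _ _ _ (q \o (fun t => 2 * t - 1))).
    by move=> t; rewrite inE /= in_itv /= => ?; apply/esym/rq; lra.
  apply: (@within_continuous_comp R R _ _ `[0, 1]%classic
    q (fun t => 2 * t - 1)) => //.
    apply: continuous_subspaceT => t; apply: continuousB; first exact: double.
    exact: cvg_cst.
  by move=> t /=; rewrite !in_itv /= => ?; lra.
- move=> t /=; rewrite in_itv /= /r => ?.
  by case: leP => ?; [apply: hp | apply: hq]; rewrite /= in_itv /=; lra.
- by rewrite /r invr_ge0 ler0n mulr0.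
- rewrite rq; last by lra.
  by rewrite mulr1 -[_ - 1]addrA subrr addr0.
Qed.

End PathComponents.

(** * Conjugation of homomorphisms by arrows *)

Lemma ginvK (G : topGroupoid) (g : G) : ginv (ginv g) = g.
Proof.
rewrite -[LHS]gmul1r src_ginv tgt_ginv -gmulVl gmulA ?src_ginv ?tgt_ginv //.
by rewrite gmulVl src_ginv gmul1l.
Qed.

Section Action.
Variables (K : topGroupType) (G : topGroupoid).
Implicit Types (phi : K -> G) (g : G).

Lemma hom_src phi k : tg_hom phi -> src (phi k) = omega phi.
Proof. by case=> [[x hx] _ _]; rewrite (hx k).1 /omega (hx _).1. Qed.

Lemma hom_tgt phi k : tg_hom phi -> tgt (phi k) = omega phi.
Proof. by case=> [[x hx] _ _]; rewrite (hx k).2 /omega (hx _).1. Qed.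

Lemma continuous_gmul (X : topologicalType) (a b : X -> G) :
  continuous a -> continuous b -> (forall x, src (a x) = tgt (b x)) ->
  continuous (fun x => gmul (a x) (b x)).
Proof.
move=> ca cb ab; apply/continuous_subspace_setT.
apply: (within_continuous_comp _ (fun p => gmul p.1 p.2)
  (fun x => (a x, b x)) _ _ (@gmul_continuous G)).
  by apply: continuous_subspaceT; exact: continuous_pair.
by move=> x _; exact: ab.
Qed.

Lemma omega_conj_hom g phi : tg_hom phi -> src g = omega phi ->
  omega (conj_hom g phi) = tgt g.
Proof.
move=> hphi e; rewrite /omega /conj_hom src_gmul ?src_ginv //.
by rewrite src_gmul ?tgt_ginv ?e ?hom_src ?hom_tgt.
Qed.

Lemma tg_hom_conj g phi : tg_hom phi -> src g = omega phi ->
  tg_hom (conj_hom g phi).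
Proof.
move=> hphi e; have gphi k : src g = tgt (phi k) by rewrite hom_tgt.
have phig k : src (phi k) = tgt (ginv g) by rewrite hom_src // tgt_ginv e.
have gphig k : src (gmul g (phi k)) = tgt (ginv g) by rewrite src_gmul.
split.
- exists (tgt g) => k.
  by rewrite src_gmul ?src_ginv // tgt_gmul // tgt_gmul.
- move=> k l; case: (hphi) => _ phiM _; rewrite /conj_hom phiM.
  have kl : src (phi k) = tgt (phi l) by rewrite hom_src ?hom_tgt.
  rewrite [RHS]gmulA ?src_gmul ?tgt_gmul ?src_ginv //.
  congr gmul; rewrite -[RHS]gmulA ?src_ginv ?tgt_gmul //.
  (* The inner factors [ginv g] and [g] meet, and their product is the unit at the target of
     [phi l]. *)
  rewrite [gmul (ginv g) _]gmulA ?src_ginv // gmulVl e.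
  by rewrite -(hom_tgt l) // gmul1l gmulA.
- case: hphi => _ _ cphi; have ccst (h : G) : continuous (fun _ : K => h).
    by move=> ?; exact: cvg_cst.
  apply: (continuous_gmul (a := fun k => gmul g (phi k)) _
    (ccst (ginv g))) => //.
  exact: (continuous_gmul (ccst g) cphi).
Qed.

(** Makes a step along the action reversible, as the symmetry of [hom_at] requires. *)
Lemma conj_homK g phi : tg_hom phi -> src g = omega phi ->
  conj_hom (ginv g) (conj_hom g phi) = phi.
Proof.
move=> hphi e; apply/funext => k; rewrite /conj_hom ginvK.
have gphi : src g = tgt (phi k) by rewrite hom_tgt.
have phig : src (phi k) = src g by rewrite hom_src // e.
rewrite gmulA ?src_ginv ?tgt_gmul ?src_gmul ?tgt_ginv //.
rewrite gmulA ?src_ginv // gmulVl gphi gmul1l.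
by rewrite -gmulA ?src_ginv ?tgt_ginv // gmulVl -phig gmul1r.
Qed.

(** Since [phi] is multiplicative, an inner automorphism of K has the effect of an arrow of G; this
    puts Inn(K) into the monodromy group. *)
Lemma conj_hom_self phi k : tg_hom phi ->
  conj_hom (phi k) phi = phi \o inner_aut k.
Proof.
move=> hphi; apply/funext => l /=.
by rewrite /conj_hom /inner_fun !homM // homV.
Qed.

End Action.

(** * Precomposition with an isomorphism of topological groups *)

Section Precomposition.
Variables (R : realType) (L K : topGroupType) (G : topGroupoid).
Variable alpha : topGroupIso L K.
Implicit Types phi psi : K -> G.

Lemma topGroupIso1 : alpha 1%g = 1%g.
Proof. by apply: (mulgI (alpha 1%g)); rewrite -tg_funM !mulg1. Qed.

Lemma omega_precomp phi : omega (phi \o alpha) = omega phi.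
Proof. by rewrite /omega /= topGroupIso1. Qed.

Lemma tg_hom_precomp phi : tg_hom phi -> tg_hom (phi \o alpha).
Proof.
case=> [[x hx] phiM cphi]; split; first by exists x => k; exact: hx.
  by move=> k l; rewrite /= tg_funM phiM.
move=> k; apply: continuous_comp; last exact: cphi.
exact: tg_fun_continuous.
Qed.

(** Typed between compact-open function spaces, so that its continuity can be stated. *)
Definition precomp (X Y Z : topologicalType) (a : X -> Y) :
  {compact-open, Y -> Z} -> {compact-open, X -> Z} := fun f => f \o a.

Lemma continuous_precomp (X Y Z : topologicalType) (a : X -> Y) :
  continuous a -> continuous (@precomp X Y Z a).
Proof.
move=> ca f.
apply/(compact_open_cvgP _ (fmap_filter _ (nbhs_filter f))) => C O cC oO fCO.
have caC : compact (a @` C).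
  by apply: continuous_compact => //; exact: continuous_subspaceT.
apply: (filterS (P := [set g : Y -> Z | g @` (a @` C) `<=` O])).
  by move=> g /= gO _ [x Cx <-]; apply: gO; exists (a x) => //; exists x.
apply: open_nbhs_nbhs; split; first exact: compact_open_open.
by move=> _ [_ [x Cx <-] <-]; apply: fCO; exists x.
Qed.

Lemma hom_path_component_precomp phi psi : hom_path_component R phi psi ->
  hom_path_component R (phi \o alpha) (psi \o alpha).
Proof.
case=> p [cp hp p0 p1]; exists (precomp alpha \o p); split.
- move=> t; apply: continuous_comp; first exact: cp.
  by apply: continuous_precomp; exact: tg_fun_continuous.
- by move=> t /hp; exact: tg_hom_precomp.
- by rewrite /= p0.
- by rewrite /= p1.
Qed.

End Precomposition.

(** * The set [hom_at R rho] as an equivalence class *)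

Section HomAt.
Variables (R : realType) (K : topGroupType) (G : topGroupoid).
Implicit Types (phi psi rho : K -> G) (A : set (K -> G)).

(** Transitivity of the path relation makes a union of path components closed under paths; by
    reflexivity, a set closed under paths is the union of the components of its points. In this form
    saturation visibly passes to intersections. *)
Lemma hom_saturatedP A : hom_saturated R A <->
  [/\ A `<=` @tg_hom K G,
      forall phi psi, A phi -> hom_path_component R phi psi -> A psi &
      forall g phi, A phi -> src g = omega phi -> A (conj_hom g phi)].
Proof.
split=> [[Ah [B _ AE] Ac]|[Ah Ap Ac]]; split => //.
  move=> phi psi; rewrite AE => -[chi Bchi chiphi] phipsi.
  by exists chi => //; exact: hom_path_component_trans phipsi.
exists A => //; apply/seteqP; split => [phi Aphi|psi [phi Aphi]].
  by exists phi => //; apply: hom_path_component_refl; exact: Ah.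
exact: Ap.
Qed.

(** Provides one saturated set around [rho], which bounds the intersection defining [hom_at]. *)
Lemma hom_saturated_tg_hom : hom_saturated R (@tg_hom K G).
Proof.
apply/hom_saturatedP; split => //.
  by move=> phi psi _ /hom_path_component_hom[].
by move=> g phi; exact: tg_hom_conj.
Qed.

Lemma hom_at_self rho : hom_at R rho rho.
Proof. exact: sub_gen_smallest. Qed.

Lemma hom_at_saturated rho : tg_hom rho -> hom_saturated R (hom_at R rho).
Proof.
move=> hrho; apply/hom_saturatedP; split.
- by apply: smallest_sub; [exact: hom_saturated_tg_hom | move=> _ ->].
- move=> phi psi Hphi phipsi A [sA rA].
  by case/hom_saturatedP: (sA) => _ Ap _; apply: Ap phipsi; exact: Hphi.
- move=> g phi Hphi e A [sA rA].
  by case/hom_saturatedP: (sA) => _ _ Ac; apply: Ac e; exact: Hphi.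
Qed.

Lemma hom_at_tg_hom rho : tg_hom rho -> hom_at R rho `<=` @tg_hom K G.
Proof. by case/hom_at_saturated. Qed.

Lemma hom_at_path rho phi psi : tg_hom rho ->
  hom_at R rho phi -> hom_path_component R phi psi -> hom_at R rho psi.
Proof. by move=> /hom_at_saturated/hom_saturatedP[_ + _]; exact. Qed.

Lemma hom_at_conj rho g phi : tg_hom rho ->
  hom_at R rho phi -> src g = omega phi -> hom_at R rho (conj_hom g phi).
Proof. by move=> /hom_at_saturated/hom_saturatedP[_ _ +]; exact. Qed.

Lemma hom_at_trans rho phi : tg_hom rho ->
  hom_at R rho phi -> hom_at R phi `<=` hom_at R rho.
Proof.
move=> hrho Hphi; apply: smallest_sub; first exact: hom_at_saturated.
by move=> _ ->.
Qed.

(** Minimality acts as an induction principle: the homomorphisms whose class contains [rho] form a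
    saturated set, because paths and conjugations can be undone. *)
Lemma hom_at_sym rho phi : tg_hom rho -> hom_at R rho phi -> hom_at R phi rho.
Proof.
move=> hrho; pose A := [set phi | tg_hom phi /\ hom_at R phi rho].
suff /[apply] : hom_at R rho `<=` A by case.
apply: smallest_sub; last by move=> _ ->; split => //; exact: hom_at_self.
apply/hom_saturatedP; split.
- by move=> ? [].
- move=> psi chi [hpsi Hpsi] psichi.
  have [_ hchi] := hom_path_component_hom psichi; split => //.
  apply: hom_at_trans Hpsi => //.
  apply: hom_at_path (hom_path_component_sym psichi) => //.
  exact: hom_at_self.
- move=> g psi [hpsi Hpsi] e; have hchi := tg_hom_conj hpsi e.
  split => //; apply: hom_at_trans Hpsi => //.
  (* Conjugation by [ginv g] leads back from [conj_hom g psi] to [psi]. *)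
  rewrite -[X in hom_at R _ X](conj_homK hpsi e).
  apply: hom_at_conj => //; first exact: hom_at_self.
  by rewrite src_ginv omega_conj_hom.
Qed.

Lemma hom_at_eq rho phi : tg_hom rho ->
  hom_at R rho phi -> hom_at R phi = hom_at R rho.
Proof.
move=> hrho Hphi; apply/seteqP; split; apply: hom_at_trans => //.
  exact: hom_at_tg_hom Hphi.
exact: hom_at_sym.
Qed.

End HomAt.

(** * Monodromy groups under precomposition *)

Section HomAtPrecomposition.
Variables (R : realType) (G : topGroupoid).

(** By minimality again: the homomorphisms with the required property form a saturated set, as
    [alpha] carries paths to paths and commutes with conjugation. *)
Lemma hom_at_precomp (L K : topGroupType) (alpha : topGroupIso L K)
    (rho phi : K -> G) :
  tg_hom rho -> hom_at R rho phi -> hom_at R (rho \o alpha) (phi \o alpha).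
Proof.
move=> hrho; have hra := tg_hom_precomp alpha hrho.
pose A := [set phi | tg_hom phi /\ hom_at R (rho \o alpha) (phi \o alpha)].
suff /[apply] : hom_at R rho `<=` A by case.
apply: smallest_sub; last by move=> _ ->; split => //; exact: hom_at_self.
apply/hom_saturatedP; split.
- by move=> ? [].
- move=> psi chi [_ Hpsi] psichi.
  have [_ hchi] := hom_path_component_hom psichi; split => //.
  by apply: hom_at_path Hpsi _ => //; exact: hom_path_component_precomp.
- move=> g psi [hpsi Hpsi] e; split; first exact: tg_hom_conj.
  rewrite -/(conj_hom g (psi \o alpha)).
  by apply: hom_at_conj => //; rewrite omega_precomp.
Qed.

Lemma hom_at_precompE (L K : topGroupType) (alpha : topGroupIso L K)
    (rho phi : K -> G) : tg_hom rho ->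
  hom_at R (rho \o alpha) (phi \o alpha) <-> hom_at R rho phi.
Proof.
move=> hrho; split; last exact: hom_at_precomp.
move=> /(hom_at_precomp (alpha := iso_inv alpha) (tg_hom_precomp alpha hrho)).
have precompK (f : K -> G) : f \o alpha \o iso_inv alpha = f.
  by apply/funext => k /=; rewrite tg_invK.
by rewrite !precompK.
Qed.

(** Classes are equal once they share a point, so it suffices to follow the single point [rho]. *)
Lemma MonP (K : topGroupType) (rho : K -> G) (mu : tgAut K) :
  tg_hom rho -> Mon R rho mu <-> hom_at R rho (rho \o mu).
Proof.
move=> hrho; split => [<-|Hmu]; first by exists rho => //; exact: hom_at_self.
apply/seteqP; split => [_ [phi Hphi <-]|phi Hphi].
  apply: hom_at_trans (Hmu) _ _ => //; exact: hom_at_precomp.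
(* This preimage of [phi] lies in the class of [rho] because [phi] lies in that of [rho \o mu],
   which is the same class. *)
exists (phi \o iso_inv mu).
  apply/(hom_at_precompE mu) => //.
  have -> : phi \o iso_inv mu \o mu = phi.
    by apply/funext => k /=; rewrite tg_funK.
  by rewrite (hom_at_eq hrho Hmu).
by apply/funext => k /=; rewrite tg_funK.
Qed.

Lemma Mon_hom_at (K : topGroupType) (rho phi : K -> G) :
  tg_hom rho -> hom_at R rho phi -> Mon R phi = Mon R rho.
Proof. by move=> hrho Hphi; rewrite /Mon (hom_at_eq hrho Hphi). Qed.

(** Conjugating [mu] by [alpha] turns [rho \o alpha] into [rho \o mu \o alpha], so the criterion
    [MonP] reads the same on both sides. *)
Lemma Mon_precomp (L K : topGroupType) (alpha : topGroupIso L K)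
    (rho : K -> G) : tg_hom rho ->
  Mon R (rho \o alpha) =
  [set iso_comp (iso_inv alpha) (iso_comp mu alpha) | mu in Mon R rho].
Proof.
move=> hrho; have hra := tg_hom_precomp alpha hrho.
have MonE (mu : tgAut K) (nu : tgAut L) :
    iso_comp (iso_inv alpha) (iso_comp mu alpha) = nu ->
    Mon R (rho \o alpha) nu <-> Mon R rho mu.
  move=> <-; rewrite !MonP // -(hom_at_precompE alpha _ hrho).
  suff -> : rho \o alpha \o iso_comp (iso_inv alpha) (iso_comp mu alpha) =
    rho \o mu \o alpha by [].
  by apply/funext => l /=; rewrite tg_invK.
apply/seteqP; split => [nu Hnu|nu [mu Hmu muE]]; last exact/(MonE _ _ muE).
have nuE : iso_comp (iso_inv alpha)
    (iso_comp (iso_comp alpha (iso_comp nu (iso_inv alpha))) alpha) = nu.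
  by apply: topGroupIso_eq => l /=; rewrite !tg_funK.
exists (iso_comp alpha (iso_comp nu (iso_inv alpha))) => //.
exact/(MonE _ _ nuE).
Qed.

(** The shape used for (iv), with the corestriction as [alpha] and the inclusion of the image as
    [rho]. *)
Lemma precomp_Mon (L K : topGroupType) (alpha : topGroupIso L K)
    (rho : K -> G) : tg_hom rho ->
  [set rho \o alpha \o mu | mu in Mon R (rho \o alpha)] =
  [set rho \o nu \o alpha | nu in Mon R rho].
Proof.
move=> hrho; rewrite Mon_precomp // image_comp.
by apply: eq_imagel => mu _; apply/funext => l /=; rewrite tg_invK.
Qed.

Lemma group_closed_Mon (K : topGroupType) (rho : K -> G) :
  tg_hom rho -> group_closed [in Mon R rho].
Proof.
move=> hrho; split; first by rewrite inE; apply/MonP => //; exact: hom_at_self.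
move=> mu nu; rewrite !inE !MonP // => Hmu Hnu.
(* Precomposing with [nu] clears the quotient, and the class of [rho \o nu] is that of [rho]. *)
rewrite -(hom_at_precompE nu) // (hom_at_eq hrho Hnu).
suff -> : rho \o (mu / nu)%g \o nu = rho \o mu by [].
by apply/funext => k /=; rewrite tg_funK.
Qed.

Lemma Inn_sub_Mon (K : topGroupType) (rho : K -> G) :
  tg_hom rho -> @Inn K `<=` Mon R rho.
Proof.
move=> hrho _ [k _ <-]; apply/MonP; rewrite // -conj_hom_self //.
by apply: hom_at_conj; rewrite ?hom_src //; exact: hom_at_self.
Qed.

End HomAtPrecomposition.

(** * Inner automorphisms *)

Section Inner.
Variable K : topGroupType.

Lemma inner_autM (k l : K) :
  inner_aut (k * l)%g = (inner_aut k * inner_aut l)%g.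
Proof.
by apply: topGroupIso_eq => x /=; rewrite /inner_fun invgM !mulgA.
Qed.

Lemma inner_autV (k : K) : inner_aut k^-1%g = (inner_aut k)^-1%g.
Proof. exact: topGroupIso_eq. Qed.

Lemma inner_aut_conj (h : tgAut K) (k : K) :
  (h * inner_aut k * h^-1)%g = inner_aut (h k).
Proof.
apply: topGroupIso_eq => x /=; rewrite /inner_fun !tg_funM tg_invK.
(* What remains is that [h] commutes with inversion. *)
congr (_ * _)%g; apply: (mulgI (h k)).
by rewrite -tg_funM !mulgV topGroupIso1.
Qed.

Lemma group_closed_Inn : group_closed [in @Inn K].
Proof.
split.
  rewrite inE; exists 1%g => //; apply: topGroupIso_eq => x /=.
  by rewrite /inner_fun mul1g invg1 mulg1.
move=> _ _ /[!inE] -[k _ <-] [l _ <-]; exists (k * l^-1)%g => //.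
by rewrite inner_autM inner_autV.
Qed.

End Inner.

(** * The corestriction of [rho] as an isomorphism onto its image *)

Section ImageIsomorphisms.
Variables (K : topGroupType) (G : topGroupoid) (rho : K -> G).
Hypothesis hrho : tg_hom rho.

Lemma image_inclE : image_incl hrho = rho \o corestr_inv (hrho := hrho).
Proof. by apply/funext => y; rewrite -{1}(corestr_invK y). Qed.

Lemma tg_hom_image_incl : tg_hom (image_incl hrho : hom_image hrho -> G).
Proof.
split => //; last exact: initial_continuous.
exists (omega rho) => y; have [k <-] := corestr_surj y.
by rewrite hom_src ?hom_tgt.
Qed.

Lemma tg_hom_copy_incl (rho_inj : injective rho) :
  tg_hom (image_incl hrho : hom_copy hrho rho_inj -> G).
Proof.
case: tg_hom_image_incl => inclst inclM _; split => //.
(* The topology of [hom_copy] makes [corestr_inv] continuous, so the inclusion is a composite of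
   continuous maps. *)
rewrite image_inclE.
have [_ _ crho] := hrho; move=> y.
apply: (@continuous_comp (hom_copy hrho rho_inj)) (crho _).
exact: initial_continuous.
Qed.

Lemma corestr_image_iso : topological_embedding rho ->
  exists c : topGroupIso K (hom_image hrho), c =1 corestr hrho.
Proof.
case=> rho_inj crho rho_open.
have cc : continuous (corestr hrho : K -> hom_image hrho).
  exact: continuous_to_initial.
have ci : continuous (corestr_inv (hrho := hrho) : hom_image hrho -> K).
  (* The embedding hypothesis writes U as the preimage of an open V under [rho]; then [corestr_inv]
     pulls U back to the trace of V on the image. *)
  apply/continuousP => U /rho_open[V oV <-]; exists V => //.
  by rewrite image_inclE.
by exists (@TopGroupIso K (hom_image hrho) _ _ (corestrK hrho rho_inj)
  (@corestr_invK _ _ _ hrho) (corestrM hrho) cc ci).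
Qed.

Lemma corestr_copy_iso (rho_inj : injective rho) :
  exists c : topGroupIso K (hom_copy hrho rho_inj), c =1 corestr hrho.
Proof.
have cc : continuous (corestr hrho : K -> hom_copy hrho rho_inj).
  apply: continuous_to_initial; rewrite /comp (funext (corestrK hrho rho_inj)).
  by move=> k; exact: cvg_id.
have ci : continuous (corestr_inv (hrho := hrho) : hom_copy hrho rho_inj -> K).
  exact: initial_continuous.
by exists (@TopGroupIso K (hom_copy hrho rho_inj) _ _ (corestrK hrho rho_inj)
  (@corestr_invK _ _ _ hrho) (corestrM hrho) cc ci).
Qed.

End ImageIsomorphisms.

Theorem proposition5 (R : realType) (G : topGroupoid) (K : topGroupType)
    (K_lc : locally_compact [set: K]) (K_hausdorff : hausdorff_space K)
    (rho : K -> G) (hrho : tg_hom rho) :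
  [/\ (* (i) *)
      forall phi : K -> G, hom_at R rho phi -> Mon R phi = Mon R rho,
      (* (ii) *)
      forall g : G, src g = omega rho -> Mon R (conj_hom g rho) = Mon R rho,
      (* (iii) *)
      forall (L : topGroupType), locally_compact [set: L] ->
        hausdorff_space L -> forall alpha : topGroupIso L K,
        Mon R (rho \o alpha) =
        [set iso_comp (iso_inv alpha) (iso_comp mu alpha) | mu in Mon R rho],
      (* (iv) *)
      (topological_embedding rho ->
        [set rho \o mu | mu in Mon R rho] =
        [set image_incl hrho \o nu \o corestr hrho
          | nu in Mon R (image_incl hrho : hom_image hrho -> G)]) /\
      (forall rho_inj : injective rho,
        [set rho \o mu | mu in Mon R rho] =
        [set image_incl hrho \o nu \o corestr hrho
          | nu in Mon R (image_incl hrho : hom_copy hrho rho_inj -> G)]) &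
      (* (v) *)
      normal_subgroup (@Inn K) (Mon R rho)].
Proof.
split.
- by move=> phi; exact: Mon_hom_at.
- move=> g e; apply: Mon_hom_at => //.
  by apply: hom_at_conj e => //; exact: hom_at_self.
- by move=> L _ _ alpha; exact: Mon_precomp.
(* In both cases the inclusion composed with the corestriction is [rho] itself, so [precomp_Mon]
   gives the claim. *)
- split=> [/(corestr_image_iso hrho)[c cE]|rho_inj].
    by have := precomp_Mon R c (tg_hom_image_incl hrho); rewrite (funext cE).
  have [c cE] := corestr_copy_iso hrho rho_inj.
  have := precomp_Mon R c (tg_hom_copy_incl hrho rho_inj).
  by rewrite (funext cE).
- split.
  + exact: group_closed_Inn.
  + exact: group_closed_Mon.
  + exact: Inn_sub_Mon.
  + by move=> _ h [k _ <-] _; exists (h k) => //; rewrite inner_aut_conj.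
Qed.
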